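(* Let $\alpha\in\mathbf{For}$ be a formula. Then $\alpha$ is valid in every relational model (that is, $\alpha$ is true in every $HT$-model) if and only if $\alpha$ is algebraically valid (that is, $h(\alpha)=1$ for every algebraic model $(A,h)$).
   Context: Language. $\mathbf{VarProp}$ is a countable set of propositional variables. $\mathbf{For}$ is the least set containing $\mathbf{VarProp}$ and closed under the binary connectives $\wedge,\vee,\Rightarrow$ and the unary connectives $\neg,S_1,S_2$ (the freely generated set of formulas). HT-algebras. An $HT$-algebra is an algebra $A=(A,0,1,\wedge,\vee,\Rightarrow,\neg,S_1,S_2)$ such that $(A,0,1,\wedge,\vee,\Rightarrow,\neg)$ is a Heyting algebra (with $\neg a=a\Rightarrow 0$), and for all $a,b\in A$ and all $i,j\in\{1,2\}$: $S_i(a\wedge b)=S_ia\wedge S_ib$; $S_i(a\vee b)=S_ia\vee S_ib$; $S_2(a\Rightarrow b)=(S_2a\Rightarrow S_2b)$; $S_1(a\Rightarrow b)=(S_1a\Rightarrow S_1b)\wedge(S_2a\Rightarrow S_2b)$; $S_iS_ja=S_ja$; $S_1a\vee a=a$; $S_1a\vee\neg S_1a=1$. Algebraic semantics. An algebraic model is a pair $(A,h)$ where $A$ is an $HT$-algebra and $h:\mathbf{For}\to A$ is a homomorphism, i.e. $h$ preserves $\wedge,\vee,\Rightarrow,\neg,S_1,S_2$. Relational semantics. An $HT$-frame is a system $K=(W,R,s_1,s_2)$ where (K0) $W$ is a nonempty set, $R$ is a binary relation on $W$, and $s_1,s_2:W\to W$ are functions, and for all $w,w'\in W$ and $i,j\in\{1,2\}$: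 (K1) $R$ is reflexive and transitive; (K2) $s_j(s_i(w))=s_j(w)$; (K3) $R(s_1(w),w)$; (K4) $R(w,s_2(w))$; (K5) $R(w,w')$ implies $R(s_i(w),s_i(w'))$ and $R(s_i(w'),s_i(w))$; (K6) for every $w\in W$ there are $i\in\{1,2\}$ and $w'\in W$ with $w=s_i(w')$. An $HT$-model based on $K$ is $M=(K,m)$ where $m:\mathbf{VarProp}\to\mathcal P(W)$ satisfies: $R(w,w')$ and $w\in m(p)$ imply $w'\in m(p)$. Satisfaction $M,w\ sat\ \alpha$ is defined recursively: $M,w\ sat\ p$ iff $w\in m(p)$; $M,w\ sat\ \alpha\wedge\beta$ iff $M,w\ sat\ \alpha$ and $M,w\ sat\ \beta$; $M,w\ sat\ \alpha\vee\beta$ iff $M,w\ sat\ \alpha$ or $M,w\ sat\ \beta$; $M,w\ sat\ \alpha\Rightarrow\beta$ iff for all $w'$, if $R(w,w')$ and $M,w'\ sat\ \alpha$ then $M,w'\ sat\ \beta$; $M,w\ sat\ \neg\alpha$ iff for all $w'$ with $R(w,w')$, not $M,w'\ sat\ \alpha$; $M,w\ sat\ S_i\alpha$ iff $M,s_i(w)\ sat\ \alpha$. A formula $\alpha$ is true in $M$ iff $M,w\ sat\ \alpha$ for every $w\in W$. *)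

(* Defs.v *)
From HB Require Import structures.
From mathcomp Require Import all_boot all_order.
From mathcomp Require Import boolp classical_sets.

Set Implicit Arguments.
Unset Strict Implicit.
Unset Printing Implicit Defensive.

Import Order.TTheory.
Local Open Scope order_scope.

(* The index set {1, 2} of the operators S_1, S_2 and the maps s_1, s_2. *)
Variant idx := one | two.

Inductive form (V : Type) : Type :=
| Var of V
| And of form V & form V
| Or of form V & form V
| Imp of form V & form V
| Not of form V
| Sop of idx & form V.

(* Bounded lattices with a residual of the meet; distributivity follows.
   The choiceType carried by a MathComp lattice is no restriction on the
   carrier: under the axioms of boolp every type has such a structure. *)
HB.mixin Record isHeyting d T of Order.TBLattice d T := {
  himp : T -> T -> T;
  le_himpE : forall a b c : T, (c <= himp a b) = (c `&` a <= b)
}.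

#[short(type="heytingType")]
HB.structure Definition Heyting d :=
  { T of isHeyting d T & Order.TBLattice d T }.

Definition hneg d (A : heytingType d) (a : A) : A := himp a \bot.

HB.mixin Record isHTAlgebra d T of Heyting d T := {
  hS : idx -> T -> T;
  hS_meet : forall i (a b : T), hS i (a `&` b) = hS i a `&` hS i b;
  hS_join : forall i (a b : T), hS i (a `|` b) = hS i a `|` hS i b;
  hS2_imp : forall a b : T, hS two (himp a b) = himp (hS two a) (hS two b);
  hS1_imp : forall a b : T,
    hS one (himp a b) =
      himp (hS one a) (hS one b) `&` himp (hS two a) (hS two b);
  hS_hS : forall i j (a : T), hS i (hS j a) = hS j a;
  hS1_joinl : forall a : T, hS one a `|` a = a;
  hS1_compl : forall a : T, hS one a `|` hneg (hS one a) = \top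
}.

#[short(type="htAlgebraType")]
HB.structure Definition HTAlgebra d :=
  { T of isHTAlgebra d T & Heyting d T }.

Record form_hom (V : Type) d (A : htAlgebraType d) (h : form V -> A) : Prop := {
  form_hom_and : forall a b, h (And a b) = h a `&` h b;
  form_hom_or : forall a b, h (Or a b) = h a `|` h b;
  form_hom_imp : forall a b, h (Imp a b) = himp (h a) (h b);
  form_hom_not : forall a, h (Not a) = hneg (h a);
  form_hom_S : forall i a, h (Sop i a) = hS i (h a)
}.

Definition algebraically_valid (V : Type) (alpha : form V) : Prop :=
  forall (d : Order.disp_t) (A : htAlgebraType d) (h : form V -> A),
    form_hom h -> h alpha = \top.

Record HTframe := {
  world :> Type;
  acc : world -> world -> Prop;
  smap : idx -> world -> world;
  world_inhabited : inhabited world;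
  acc_refl : forall w, acc w w;
  acc_trans : forall w1 w2 w3, acc w1 w2 -> acc w2 w3 -> acc w1 w3;
  smap_smap : forall i j w, smap j (smap i w) = smap j w;
  acc_smap1 : forall w, acc (smap one w) w;
  acc_smap2 : forall w, acc w (smap two w);
  smap_acc : forall i w w', acc w w' ->
    acc (smap i w) (smap i w') /\ acc (smap i w') (smap i w);
  smap_onto : forall w, exists i w', w = smap i w'
}.

Record HTmodel (V : Type) := {
  frame :> HTframe;
  val : V -> set frame;
  val_mono : forall p (w w' : frame), acc w w' -> val p w -> val p w'
}.

Fixpoint sat (V : Type) (M : HTmodel V) (w : M) (alpha : form V) : Prop :=
  match alpha with
  | Var p => val p w
  | And a b => sat w a /\ sat w b
  | Or a b => sat w a \/ sat w b
  | Imp a b => forall w' : M, acc w w' -> sat w' a -> sat w' b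
  | Not a => forall w' : M, acc w w' -> ~ sat w' a
  | Sop i a => sat (smap i w) a
  end.

Definition true_in (V : Type) (M : HTmodel V) (alpha : form V) : Prop :=
  forall w : M, sat w alpha.

Definition relationally_valid (V : Type) (alpha : form V) : Prop :=
  forall M : HTmodel V, true_in M alpha.

(* Main.v *)
From HB Require Import structures.
From mathcomp Require Import all_boot all_order.
From mathcomp Require Import boolp classical_sets.
Require Import Defs.

(** Stone duality.  The up-sets of an [HT]-frame form an [HT]-algebra, with
    [S_i U] the preimage of [U] under [s_i], and sending a formula to the set
    of worlds satisfying it is a homomorphism.  Conversely the prime filters
    of an [HT]-algebra, ordered by inclusion, form an [HT]-frame with
    [s_i F = {a | S_i a \in F}]; satisfaction at a prime filter is membership,
    and every element other than [\top] is avoided by some prime filter. *)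

Set Implicit Arguments.
Unset Strict Implicit.
Unset Printing Implicit Defensive.

Import Order.TTheory.
Local Open Scope order_scope.

(** * The algebra of up-sets of a frame *)

Section FrameTheory.
Variable K : HTframe.
Implicit Types w v : K.

(* By (K6) every world is fixed by some [s_j], so (K5) makes every world above
   [s_i w] equivalent to [s_1 w] or [s_2 w]. *)
Lemma acc_smap_equiv i w v : acc (smap i w) v ->
  exists j, acc v (smap j w) /\ acc (smap j w) v.
Proof.
case: (smap_onto v) => j [u ->] /(smap_acc j) [].
by rewrite !smap_smap; exists j.
Qed.

Lemma acc_smap12 w : acc (smap one w) (smap two w).
Proof. exact: acc_trans (acc_smap1 w) (acc_smap2 w). Qed.

(** A world above [smap two w] is equivalent to [smap one w] or to [smap two w], and the former lies
    below the latter, so [smap two w] is maximal up to equivalence. *)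
Lemma acc_smap2_sym w v : acc (smap two w) v -> acc v (smap two w).
Proof.
by move=> /acc_smap_equiv [[|] [vw _]] //; apply: acc_trans vw (acc_smap12 w).
Qed.

End FrameTheory.

Identity Coercion fun_of_set : set >-> Funclass.

Record upset (K : HTframe) := Upset {
  upset_set :> set K;
  upset_up : forall w w' : K, acc w w' -> upset_set w -> upset_set w'
}.

Fact upset_display : Order.disp_t. Proof. exact: Order.Disp tt tt. Qed.

HB.instance Definition _ K := gen_eqMixin (upset K).
HB.instance Definition _ K := gen_choiceMixin (upset K).

Section UpsetAlgebra.
Variable K : HTframe.
Implicit Types (i j : idx) (U V X : upset K).

Lemma upset_eqP U V : (forall w, U w <-> V w) -> U = V.
Proof.
case: U V => U uU [V uV] /= UV.
have {}UV : U = V by apply/funext => w; apply/propext.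
by subst V; congr Upset; apply: Prop_irrelevance.
Qed.

Definition upset_le U V := `[< forall w, U w -> V w >].

Lemma upset_le_refl : reflexive upset_le.
Proof. by move=> U; apply/asboolP. Qed.

Lemma upset_le_anti : antisymmetric upset_le.
Proof.
move=> U V /andP [/asboolP UV /asboolP VU].
by apply: upset_eqP => w; split; [apply: UV|apply: VU].
Qed.

Lemma upset_le_trans : transitive upset_le.
Proof.
move=> V U X /asboolP UV /asboolP VX; apply/asboolP => w /UV; exact: VX.
Qed.

HB.instance Definition _ :=
  Order.Le_isPOrder.Build upset_display (upset K)
    upset_le_refl upset_le_anti upset_le_trans.

Lemma upset_leP U V : reflect (forall w, U w -> V w) (U <= V).
Proof. exact: asboolP. Qed.

(** This and the following operations end with [Defined], so that membership unfolds by
    conversion. *)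
Definition upset_meet U V : upset K.
Proof.
exists (fun w => U w /\ V w) => w w' ww' [Uw Vw].
by split; [apply: upset_up ww' Uw|apply: upset_up ww' Vw].
Defined.

Definition upset_join U V : upset K.
Proof.
exists (fun w => U w \/ V w) => w w' ww' [Uw|Vw].
- by left; apply: upset_up ww' Uw.
- by right; apply: upset_up ww' Vw.
Defined.

Definition upset_imp U V : upset K.
Proof.
exists (fun w => forall w', acc w w' -> U w' -> V w') => w w' ww' UV v w'v.
exact/UV/(acc_trans ww').
Defined.

Definition upset_S i U : upset K.
Proof.
exists (fun w => U (smap i w)) => w w' /(smap_acc i) [ww' _].
exact: upset_up ww'.
Defined.

Definition upset_bot : upset K.
Proof. by exists (fun=> False). Defined.

Definition upset_top : upset K.
Proof. by exists (fun=> True). Defined.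

Lemma upset_meetP U V X : (U <= upset_meet V X) = (U <= V) && (U <= X).
Proof.
apply/upset_leP/andP => [UVX|[/upset_leP UV /upset_leP UX] w Uw].
  by split; apply/upset_leP => w /UVX [].
by split; [apply: UV|apply: UX].
Qed.

Lemma upset_joinP U V X : (upset_join U V <= X) = (U <= X) && (V <= X).
Proof.
apply/upset_leP/andP => [UVX|[/upset_leP UX /upset_leP VX] w [/UX|/VX] //].
by split; apply/upset_leP => w Uw; apply: UVX; [left|right].
Qed.

HB.instance Definition _ :=
  Order.POrder_MeetJoin_isLattice.Build upset_display (upset K)
    upset_meetP upset_joinP.

Lemma upset_le0 U : upset_bot <= U.
Proof. exact/upset_leP. Qed.

Lemma upset_le1 U : U <= upset_top.
Proof. exact/upset_leP. Qed.

HB.instance Definition _ :=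
  Order.hasBottom.Build upset_display (upset K) upset_le0.
HB.instance Definition _ :=
  Order.hasTop.Build upset_display (upset K) upset_le1.

Lemma upset_le_impE U V X : (X <= upset_imp U V) = (X `&` U <= V).
Proof.
apply/upset_leP/upset_leP => [XUV w [/XUV UV]|XUV w Xw w' ww' Uw'].
  exact/UV/acc_refl.
by apply: XUV; split=> //; apply: upset_up ww' Xw.
Qed.

HB.instance Definition _ :=
  isHeyting.Build upset_display (upset K) upset_le_impE.

Lemma upset_S_meet i U V : upset_S i (U `&` V) = upset_S i U `&` upset_S i V.
Proof. exact: upset_eqP. Qed.

Lemma upset_S_join i U V : upset_S i (U `|` V) = upset_S i U `|` upset_S i V.
Proof. exact: upset_eqP. Qed.

Lemma upset_S2_imp U V :
  upset_S two (himp U V) = himp (upset_S two U) (upset_S two V).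
Proof.
apply: upset_eqP => w; split=> [UV v /(smap_acc two) [wv _]|UV v wv Uv].
  exact: UV.
(* By maximality [v] is equivalent to [smap two w], so the hypothesis is used only at [w] itself. *)
apply: (upset_up wv); apply: (UV w (acc_refl w)).
exact: (upset_up (acc_smap2_sym wv) Uv).
Qed.

(** Up to equivalence the worlds above [smap one w] are [smap one w] and [smap two w]; each conjunct
    on the right settles one of them. *)
Lemma upset_S1_imp U V :
  upset_S one (himp U V) =
    himp (upset_S one U) (upset_S one V) `&` himp (upset_S two U) (upset_S two V).
Proof.
apply: upset_eqP => w; split=> [UV|[UV1 UV2] v /acc_smap_equiv [j [vw wv]] Uv].
  split=> v wv; [have [wv' _] := smap_acc one wv|have [wv' _] := smap_acc two wv].
    exact: UV.
  exact/UV/acc_trans/wv'/acc_smap12.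
apply: (upset_up wv); have {}Uv := upset_up vw Uv.
by case: j {vw wv} Uv => Uw; [apply: UV1|apply: UV2] => //; apply: acc_refl.
Qed.

Lemma upset_S_S i j U : upset_S i (upset_S j U) = upset_S j U.
Proof. by apply: upset_eqP => w /=; rewrite smap_smap. Qed.

Lemma upset_S1_joinl U : upset_S one U `|` U = U.
Proof.
apply/join_idPr/upset_leP => w /=; apply: upset_up; exact: acc_smap1.
Qed.

(** By (K5) the preimage of an up-set under [smap one] is also closed downwards, so its
    set-theoretic complement is its negation. *)
Lemma upset_S1_compl U : upset_S one U `|` hneg (upset_S one U) = \top.
Proof.
apply: upset_eqP => w; split=> // _.
have [Uw|nUw] := pselect (U (smap one w)); [by left|right].
move=> v /(smap_acc one) [_ vw] Uv; exact/nUw/(upset_up vw).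
Qed.

HB.instance Definition _ :=
  isHTAlgebra.Build upset_display (upset K)
    upset_S_meet upset_S_join upset_S2_imp upset_S1_imp upset_S_S
    upset_S1_joinl upset_S1_compl.

End UpsetAlgebra.

(** * Truth sets of formulas *)

Lemma sat_acc (V : Type) (M : HTmodel V) (alpha : form V) (w w' : M) :
  acc w w' -> sat w alpha -> sat w' alpha.
Proof.
elim: alpha w w' => [p|a IHa b IHb|a IHa b IHb|a _ b _|a _|i a IHa] w w' ww' /=.
- exact: val_mono.
- by move=> [/(IHa _ _ ww') ? /(IHb _ _ ww')].
- by move=> [/(IHa _ _ ww')|/(IHb _ _ ww')]; [left|right].
- by move=> ab v w'v; apply/ab/(acc_trans ww').
- by move=> na v w'v; apply/na/(acc_trans ww').
- by apply: IHa; have [] := smap_acc i ww'.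
Qed.

Definition truth_set (V : Type) (M : HTmodel V) (alpha : form V) : upset M :=
  Upset (fun w w' => @sat_acc V M alpha w w').

Lemma truth_set_hom (V : Type) (M : HTmodel V) : form_hom (@truth_set V M).
Proof. by split=> *; apply: upset_eqP. Qed.

(** * The frame of prime filters of an algebra *)

(** Improper filters are allowed: [filter_himp] produces one when [himp a \bot] lies in [F]. *)
Record filter (d : Order.disp_t) (A : tbLatticeType d) (F : set A) : Prop := {
  filter_top : F \top;
  filter_le : forall a b, a <= b -> F a -> F b;
  filter_meet : forall a b, F a -> F b -> F (a `&` b)
}.

Record prime_filter (d : Order.disp_t) (A : tbLatticeType d) := PrimeFilter {
  prime_filter_set :> set A;
  prime_filterP : filter prime_filter_set;
  prime_filter_bot : ~ prime_filter_set \bot;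
  prime_filter_join : forall a b,
    prime_filter_set (a `|` b) -> prime_filter_set a \/ prime_filter_set b
}.

(** * Filters of Heyting algebras and the prime filter theorem *)

Section HeytingFilters.
Context {d : Order.disp_t} {A : heytingType d}.
Implicit Types (a b c : A) (F : set A).

Lemma himp_meet a b : himp a b `&` a <= b.
Proof. by rewrite -le_himpE. Qed.

Lemma himp_eqT a b : (himp a b == \top) = (a <= b).
Proof. by rewrite -le1x le_himpE meet1x. Qed.

Lemma himp_top a b : a <= b -> himp a b = \top.
Proof. by rewrite -himp_eqT => /eqP. Qed.

(** This set is the filter generated by [F] and [a], expressed through residuation. *)
Lemma filter_himp F a : filter F -> filter [set b | F (himp a b)].
Proof.
move=> [FT Fle Fm]; split=> /= [|b c bc|b c Fb Fc].
- by rewrite himp_top ?lex1.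
- by apply: Fle; rewrite le_himpE; apply: le_trans (himp_meet _ _) bc.
- apply: Fle (Fm _ _ Fb Fc); rewrite le_himpE lexI.
  apply/andP; split; [apply: le_trans (himp_meet a b)|apply: le_trans (himp_meet a c)].
    exact: leI2 (leIl _ _) (lexx _).
  exact: leI2 (leIr _ _) (lexx _).
Qed.

Lemma sub_filter_himp F a : filter F -> (F `<=` [set b | F (himp a b)])%classic.
Proof. by move=> filF b; apply: (filter_le filF); rewrite le_himpE leIl. Qed.

(** Zorn's lemma gives a filter [G] maximal among those that contain [F] and omit [a]; maximality
    forces primeness. *)
Lemma prime_filter_extension F a : filter F -> ~ F a ->
  exists G : prime_filter A, (F `<=` G)%classic /\ ~ G a.
Proof.
move=> filF nFa.
(* [set0] is admitted because [Zorn_bigcup] ranges over empty chains too. *)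
pose P X := X = set0 \/ [/\ filter X, (F `<=` X)%classic & ~ X a].
have [C CP totC|G [PG maxG]] := @Zorn_bigcup A P.
  have [C0|/existsNP [X /not_implyP [CX X0]]] :=
      pselect (forall X, C X -> X = set0); [left|right].
    by rewrite -subset0 => x [X /C0 ->].
  have CF Y y : C Y -> Y y -> [/\ filter Y, (F `<=` Y)%classic & ~ Y a].
    by move=> /CP [->|].
  have [x Xx] : exists x, X x by apply/set0P/eqP.
  have [filX FX nXa] := CF X x CX Xx.
  split; last by move=> [Y CY Ya]; have [_ _] := CF Y a CY Ya; apply.
    split; first by exists X => //; exact: filter_top.
      move=> b c bc [Y CY Yb]; exists Y => //.
      by have [filY _ _] := CF Y b CY Yb; apply: filter_le bc Yb.
    move=> b c [Y CY Yb] [Z CZ Zc].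
    have [filY _ _] := CF Y b CY Yb; have [filZ _ _] := CF Z c CZ Zc.
    have [YZ|ZY] := totC Y Z CY CZ.
      by exists Z => //; apply: filter_meet => //; apply: YZ.
    by exists Y => //; apply: filter_meet => //; apply: ZY.
  by move=> b Fb; exists X => //; apply: FX.
case: PG => [G0|[filG FG nGa]].
  have [] := maxG F; last by right; split.
  by rewrite G0; split=> // /(_ _ (filter_top filF)).
(* For [b] outside [G], the filter generated by [G] and [b] is strictly larger, so it must contain
   [a]. *)
have maxGa b : ~ G b -> G (himp b a).
  move=> nGb; apply: contrapT => nGba.
  apply: (maxG [set c | G (himp b c)]%classic).
    split; first by apply: sub_filter_himp.
    move=> /(_ b) /= Gb; apply: nGb; apply: Gb.
    by rewrite himp_top //; exact: filter_top filG.
  right; split=> //; first exact: filter_himp.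
  by move=> c /FG; apply: sub_filter_himp.
have nG0 : ~ G \bot by move=> /(filter_le filG (le0x a)).
have primeG b c : G (b `|` c) -> G b \/ G c.
  move=> Gbc; have [Gb|nGb] := pselect (G b); [by left|right].
  apply: contrapT => nGc; apply: nGa.
  have Gbca := filter_meet filG (filter_meet filG (maxGa b nGb) (maxGa c nGc)) Gbc.
  apply: filter_le Gbca => //.
  rewrite meetC -le_himpE leUx !le_himpE; apply/andP; split.
    by apply: le_trans (himp_meet b a); rewrite meetC; apply: leI2 (leIl _ _) (lexx _).
  by apply: le_trans (himp_meet c a); rewrite meetC; apply: leI2 (leIr _ _) (lexx _).
by exists (PrimeFilter filG nG0 primeG).
Qed.

(** For the converse, if [himp a b] is not in [F], the filter generated by [F] and [a] omits [b] and
    extends to a prime filter omitting [b]. *)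
Lemma himp_prime_filter F a b : filter F ->
  F (himp a b) <->
  (forall G : prime_filter A, (F `<=` G)%classic -> G a -> G b).
Proof.
move=> filF; split=> [Fab G FG Ga|FGab].
  have Gab := filter_meet (prime_filterP G) (FG _ Fab) Ga.
  exact: (filter_le (prime_filterP G) (himp_meet a b) Gab).
apply: contrapT => nFab.
have [G [FG nGb]] := prime_filter_extension (filter_himp a filF) nFab.
apply/nGb/FGab; first by move=> c /(sub_filter_himp a filF)/FG.
by apply: FG; rewrite /= himp_top //; exact: filter_top filF.
Qed.

End HeytingFilters.

(** * The operators and the prime filters of an HT-algebra *)

Section PrimeFilterFrame.
Context {d : Order.disp_t} {A : htAlgebraType d}.
Implicit Types (a b : A) (F G : prime_filter A) (i j : idx).

Lemma hS_le i a b : a <= b -> hS i a <= hS i b.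
Proof. by move=> /meet_idPl ab; apply/meet_idPl; rewrite -hS_meet ab. Qed.

Lemma hS1_le a : hS one a <= a.
Proof. by apply/join_idPr; rewrite hS1_joinl. Qed.

Lemma hS1_le_hS2 a : hS one a <= hS two a.
Proof. by rewrite -(hS_hS two one); apply/hS_le/hS1_le. Qed.

(* [S_1] reflects [\top], since [S_1 a <= a]; applied to [a => b] this shows
   that [S_1] and [S_2] jointly reflect the order. *)
Lemma le_of_hS a b : hS one a <= hS one b -> hS two a <= hS two b -> a <= b.
Proof.
rewrite -![_ <= _]himp_eqT => /eqP ab1 /eqP ab2.
by rewrite -le1x; apply: le_trans (hS1_le _); rewrite hS1_imp ab1 ab2 meetxx.
Qed.

Lemma le_hS2 a : a <= hS two a.
Proof. by apply: le_of_hS; rewrite !hS_hS // hS1_le_hS2. Qed.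

(** Since [\top] is [himp \bot \bot], the axiom [hS1_imp] gives the case of [hS one]; the other
    index follows by absorption. *)
Lemma hS_top i : hS i \top = \top :> A.
Proof.
have T1 : hS one \top = \top :> A.
  by rewrite -[X in hS one X](himp_top (lexx \bot)) hS1_imp !himp_top ?meetxx.
by rewrite -[X in hS i X]T1 hS_hS T1.
Qed.

Lemma hS_bot i : hS i \bot = \bot :> A.
Proof.
have B1 : hS one \bot = \bot :> A by apply/eqP; rewrite -lex0 hS1_le.
by rewrite -[X in hS i X]B1 hS_hS B1.
Qed.

(* Checked on [S_1] and [S_2] separately by [le_of_hS]; it is what gives (K6). *)
Lemma hS_interpolation a b : a `&` hS two b <= hS one a `|` b.
Proof.
apply: le_of_hS; rewrite hS_meet hS_join !hS_hS.
  by apply: le_trans (leIl _ _) (leUl _ _).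
by apply: le_trans (leIr _ _) (leUr _ _).
Qed.

Lemma prime_filter_eqP F G : (forall a, F a <-> G a) -> F = G.
Proof.
case: F G => F filF F0 Fj [G filG G0 Gj] /= FG.
have {}FG : F = G by apply/funext => a; apply/propext.
by subst G; congr PrimeFilter; apply: Prop_irrelevance.
Qed.

Definition prime_filter_smap i F : prime_filter A.
Proof.
exists [set a | F (hS i a)]%classic => /=.
- split=> /= [|a b /(hS_le i)|a b].
  + by rewrite hS_top; apply: filter_top (prime_filterP F).
  + exact: (filter_le (prime_filterP F)).
  + by rewrite hS_meet; exact: (filter_meet (prime_filterP F)).
- by rewrite hS_bot; apply: prime_filter_bot.
- by move=> a b; rewrite hS_join; apply: prime_filter_join.
Defined.

Lemma prime_filter_smap_smap i j F :
  prime_filter_smap j (prime_filter_smap i F) = prime_filter_smap j F.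
Proof. by apply: prime_filter_eqP => a /=; rewrite hS_hS. Qed.

Lemma prime_filter_smap1 F : (prime_filter_smap one F `<=` F)%classic.
Proof. by move=> a; apply: (filter_le (prime_filterP F) (hS1_le a)). Qed.

Lemma prime_filter_smap2 F : (F `<=` prime_filter_smap two F)%classic.
Proof. by move=> a; apply: (filter_le (prime_filterP F) (le_hS2 a)). Qed.

(** Every [hS i a] equals [hS one (hS i a)], hence is complemented. If [F] lacked it, [F] and then
    [G] would contain its negation. *)
Lemma prime_filter_smap_sub i F G : (F `<=` G)%classic ->
  (prime_filter_smap i F `<=` prime_filter_smap i G)%classic /\
  (prime_filter_smap i G `<=` prime_filter_smap i F)%classic.
Proof.
move=> FG; split=> a /=; first exact: FG.
move=> Ga; have : F (hS i a `|` hneg (hS i a)).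
  rewrite -(hS_hS one i) hS1_compl; exact: filter_top (prime_filterP F).
move=> /prime_filter_join [//|/FG nGa].
have Ga0 := filter_meet (prime_filterP G) nGa Ga.
have := filter_le (prime_filterP G) (himp_meet (hS i a) \bot) Ga0.
by move=> /prime_filter_bot.
Qed.

(** Either [F] is fixed by [prime_filter_smap one], or some [a] in [F] has [hS one a] outside [F];
    then interpolation and primeness make [F] fixed by [prime_filter_smap two]. *)
Lemma prime_filter_smap_onto F : exists i G, F = prime_filter_smap i G.
Proof.
have [F1|/existsNP [a /not_implyP [Fa nF1a]]] :=
    pselect (forall a, F a -> F (hS one a)).
  exists one, F; apply: prime_filter_eqP => a; split; first exact: F1.
  exact: prime_filter_smap1.
exists two, F; apply: prime_filter_eqP => b; split; first exact: prime_filter_smap2.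
move=> F2b; have Fab := filter_meet (prime_filterP F) Fa F2b.
have := filter_le (prime_filterP F) (hS_interpolation a b) Fab.
by move=> /prime_filter_join [].
Qed.

(** The parameter [F] witnesses inhabitation: a one-element algebra has no prime filters. *)
Definition prime_filter_frame (F : prime_filter A) : HTframe := {|
  world := prime_filter A;
  acc := fun G G' => (G `<=` G')%classic;
  smap := prime_filter_smap;
  world_inhabited := inhabits F;
  acc_refl := fun=> @subset_refl _ _;
  acc_trans := fun _ _ _ => @subset_trans _ _ _ _;
  smap_smap := prime_filter_smap_smap;
  acc_smap1 := prime_filter_smap1;
  acc_smap2 := prime_filter_smap2;
  smap_acc := prime_filter_smap_sub;
  smap_onto := prime_filter_smap_onto
|}.

Definition prime_filter_model (V : Type) (h : form V -> A) (F : prime_filter A) :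
  HTmodel V :=
  @Build_HTmodel V (prime_filter_frame F)
    (fun p (G : prime_filter A) => G (h (Var p))) (fun p _ _ GG' => GG' _).

(** Induction on the formula: primeness handles disjunction, and [himp_prime_filter] handles
    implication and, as prime filters omit [\bot], negation. *)
Lemma prime_filter_satP (V : Type) (h : form V -> A) (F : prime_filter A) :
  form_hom h -> forall (alpha : form V) (G : prime_filter A),
  @sat V (prime_filter_model h F) G alpha <-> G (h alpha).
Proof.
move=> [hA hO hI hN hs].
elim=> [p|a IHa b IHb|a IHa b IHb|a IHa b IHb|a IHa|i a IHa] G //=.
- rewrite hA IHa IHb; split=> [[Ga Gb]|Gab].
    exact: (filter_meet (prime_filterP G) Ga Gb).
  by split; apply: (filter_le (prime_filterP G) _ Gab); rewrite ?leIl ?leIr.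
- rewrite hO IHa IHb; split; last exact: prime_filter_join.
  by move=> [] Ga; apply: (filter_le (prime_filterP G) _ Ga); rewrite ?leUl ?leUr.
- rewrite hI himp_prime_filter; last exact: prime_filterP.
  by split=> ab G' GG'; have := ab G' GG'; rewrite IHa IHb.
- rewrite hN himp_prime_filter; last exact: prime_filterP.
  split=> ab G' GG'; have := ab G' GG'; rewrite IHa //.
  by move=> na /na; apply: prime_filter_bot.
- by rewrite hs IHa.
Qed.

End PrimeFilterFrame.

Theorem theorem5p6 (V : countType) (alpha : form V) :
  relationally_valid alpha <-> algebraically_valid alpha.
Proof.
split=> [valid d A h hom_h|valid M w].
  apply/eqP; rewrite -le1x; apply: contrapT => nalpha.
  (* The set is the least filter, whose only element is [\top]; it omits [h alpha]. *)
  have filT : filter [set a : A | \top <= a]%classic.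
    split=> //= [a b ab Ta|a b Ta Tb]; first exact: le_trans Ta ab.
    by rewrite lexI Ta Tb.
  have [F [_ nFalpha]] := prime_filter_extension filT nalpha.
  apply: nFalpha; apply/(prime_filter_satP F hom_h).
  exact: (valid (prime_filter_model h F) F).
(* Validity is applied to the algebra of up-sets of the model, where [\top] is the set of all
   worlds. *)
have Mtop := valid _ _ _ (truth_set_hom M).
have : truth_set M alpha w by rewrite Mtop.
by [].
Qed.
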